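(* Consider the single-layer self-attention model and loss $\mathcal{L}$ described in the context. Let $W_K(t),W_Q(t)\in\mathbb{R}^{d\times d}$ follow gradient flow on the loss under the factorized parameterization $W_{QK}=W_KW_Q^\top$, with balanced initialization $W_Q(0)^\top W_Q(0)=W_K(0)^\top W_K(0)$. Let $\widetilde W_{QK}=W_KW_Q^\top$ be the resulting product matrix, and let $W_{QK}$ be the collapsed parameter, whose own gradient flow is $\frac{\partial W_{QK}}{\partial t}=-\nabla_{W_{QK}}\mathcal{L}$. Then, with the collapsed parameter and its velocity taken at the point $W_{QK}=\widetilde W_{QK}(t)$, $$\operatorname{vec}\Big(\frac{\partial\widetilde W_{QK}}{\partial t}\Big)=\Omega(W_{QK})\,\operatorname{vec}\Big(\frac{\partial W_{QK}}{\partial t}\Big),$$ where $$\Omega(C):=(C^\top C)^{1/2}\otimes I_d+I_d\otimes(CC^\top)^{1/2},\qquad C\in\mathbb{R}^{d\times d},$$ and $\Omega(\alpha C)=\alpha\,\Omega(C)$ for scalars $\alpha$ (homogeneity of degree 1).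
   Context: Model: for a sequence $X\in\mathbb{R}^{T\times d}$ with last row $x_T^\top$ (the query token), output-value parameters $W_O\in\mathbb{R}^{M\times d}$, $W_V\in\mathbb{R}^{d\times d}$, and $W_{QK}\in\mathbb{R}^{d\times d}$, the attention vector is $A=\mathrm{softmax}(XW_{QK}x_T)$ and the logits are $\hat y=W_OW_VX^\top A$. With label $c\in\{1,\dots,M\}$, the loss is $\mathcal{L}=-\log\mathrm{softmax}_c(\hat y)$, where $\mathrm{softmax}_i(u)=e^{u_i}/\sum_je^{u_j}$. No assumption is made on $W_O,W_V$; they may be constant or may vary with $t$, and gradients at time $t$ are evaluated at their current values. Gradient flow in the factorized parameterization means $\dot W_K=-\nabla_{W_K}\mathcal{L}$, $\dot W_Q=-\nabla_{W_Q}\mathcal{L}$, with $\mathcal{L}$ evaluated at $W_{QK}=W_KW_Q^\top$. $\operatorname{vec}$ stacks the columns of a matrix, $\otimes$ is the Kronecker product, and $P^{1/2}$ is the positive semidefinite square root of a positive semidefinite matrix $P$.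
   Formalization: Homogeneity Ω(αC)=αΩ(C) is stated for scalars α≥0 only; for negative α it is false because the square root is the positive semidefinite one (d=1, C=1, α=−1 gives Ω(αC)=2, not −2). *)

(* Defs.v *)
From HB Require Import structures.
From mathcomp Require Import all_boot all_order all_algebra.
From mathcomp Require Import mxtens.
From mathcomp Require Import all_classical all_reals all_analysis.

Set Implicit Arguments.
Unset Strict Implicit.
Unset Printing Implicit Defensive.

Import Order.TTheory GRing.Theory Num.Theory.
Import numFieldNormedType.Exports.
Local Open Scope classical_set_scope.
Local Open Scope ring_scope.

(* MathComp-Analysis, over an arbitrary R : realType.
   Sequences have length n.+1, so that the query (last) token exists; tokens
   are the rows of X, and all vectors are columns. *)

Definition softmax (R : realType) (k : nat) (u : 'cV[R]_k) : 'cV[R]_k :=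
  \col_i (expR (u i 0) / \sum_(j < k) expR (u j 0)).

Definition query (R : realType) (n d : nat) (X : 'M[R]_(n.+1, d)) : 'cV[R]_d :=
  (row ord_max X)^T.

Definition attention (R : realType) (n d : nat) (X : 'M[R]_(n.+1, d))
    (WQK : 'M[R]_d) : 'cV[R]_n.+1 :=
  softmax (X *m WQK *m query X).

Definition logits (R : realType) (n d M : nat) (WO : 'M[R]_(M, d))
    (WV : 'M[R]_d) (X : 'M[R]_(n.+1, d)) (WQK : 'M[R]_d) : 'cV[R]_M :=
  WO *m WV *m X^T *m attention X WQK.

Definition loss (R : realType) (n d M : nat) (WO : 'M[R]_(M, d))
    (WV : 'M[R]_d) (X : 'M[R]_(n.+1, d)) (c : 'I_M) (WQK : 'M[R]_d) : R :=
  - ln (softmax (logits WO WV X WQK) c 0).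

Definition grad (R : realType) (m n : nat) (f : 'M[R]_(m, n) -> R)
    (W : 'M[R]_(m, n)) : 'M[R]_(m, n) :=
  \matrix_(i, j) ('D_(delta_mx i j) f W).

(* V is the derivative at t of W relative to the time domain J: the right
   derivative at the left end point of an interval J, and the usual derivative
   at its interior points. *)
Definition has_velocity (R : realType) (m n : nat) (J : set R)
    (W : R -> 'M[R]_(m, n)) (t : R) (V : 'M[R]_(m, n)) : Prop :=
  (s - t)^-1 *: (W s - W t) @[s --> within J t^'] --> V.

(* [0, tau), with tau = +oo allowed. *)
Definition time_domain (R : realType) (tau : \bar R) : set R :=
  [set t | 0 <= t /\ (t%:E < tau)%E].

Definition is_psd (R : realType) (d : nat) (P : 'M[R]_d) : Prop :=
  P^T = P /\ forall x : 'cV[R]_d, 0 <= (x^T *m P *m x) 0 0.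

(* P^(1/2); only meaningful when P is positive semidefinite, in which case the
   positive semidefinite square root exists and is unique. *)
Definition psd_sqrt (R : realType) (d : nat) (P : 'M[R]_d) : 'M[R]_d :=
  get [set S : 'M[R]_d | is_psd S /\ S *m S = P].

(* mxvec concatenates rows, hence the transpose to stack columns. *)
Definition vec (R : realType) (m n : nat) (A : 'M[R]_(m, n)) : 'cV[R]_(n * m) :=
  (mxvec A^T)^T.

(* tensmx is the Kronecker product. *)
Definition Omega (R : realType) (d : nat) (C : 'M[R]_d) : 'M[R]_(d * d) :=
  tensmx (psd_sqrt (C^T *m C)) 1%:M + tensmx 1%:M (psd_sqrt (C *m C^T)).

(* Main.v *)
Require Import Defs.
From HB Require Import structures.
From mathcomp Require Import all_boot all_order all_algebra.
From mathcomp Require Import mxtens ring lra.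
From mathcomp Require Import all_classical all_reals all_analysis.
Import Order.TTheory GRing.Theory Num.Theory.
Import numFieldNormedType.Exports.
Local Open Scope classical_set_scope.
Local Open Scope ring_scope.

(* With G := - grad L at W = K Q^T, the chain rule turns the factorized flow
   into K' = G Q and Q' = G^T K, whatever the time dependence of G. Hence
   Q^T Q - K^T K has zero velocity and stays 0. The balance Q^T Q = K^T K gives
   (Q Q^T)^2 = W^T W and (K K^T)^2 = W W^T, so that Q Q^T and K K^T are the
   psd square roots in Omega W; and W' = G (Q Q^T) + (K K^T) G. *)

(** * Vectorization and the Kronecker product *)

Lemma index_allpairs (S T : eqType) (s : seq S) (t : seq T) x y :
  x \in s -> y \in t ->
  index (x, y) [seq (a, b) | a <- s, b <- t] = (index x s * size t + index y t)%N.
Proof.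
move=> + yt; elim: s => //= a s IHs.
have pairI b : injective (pair b : T -> S * T) by move=> u v [].
rewrite index_cat in_cons eq_sym; case: eqVneq => [-> _|ax /= xs].
  by rewrite map_f // index_map.
rewrite ifN ?IHs // ?size_map ?mulSn ?addnA//.
by apply/mapP => -[b _ [xa _]]; rewrite xa eqxx in ax.
Qed.

(** [mxvec_index] is a rank in the enumeration of pairs, [mxtens_index] an arithmetic row-major
    position; they agree because that enumeration is lexicographic, which is what [index_allpairs]
    expresses. *)
Lemma mxvec_index_tens {m n : nat} (i : 'I_m) (j : 'I_n) :
  mxvec_index i j = mxtens_index (i, j).
Proof.
apply: val_inj => /=.
have /(congr1 (index^~ (enum {: 'I_m * 'I_n}))) :=
  nth_enum_rank (i, j) (i, j).
rewrite index_uniq ?enum_uniq -?cardE // => ->.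
rewrite enumT unlock/= /prod_enum index_allpairs ?mem_enum //.
by rewrite !index_enum_ord size_enum_ord.
Qed.

Lemma vec_mulmx {R : realType} {m n p q : nat} (A : 'M[R]_(m, n))
    (X : 'M[R]_(n, p)) (B : 'M[R]_(p, q)) :
  (* Stacking columns indexes entries by (column, row), so the right factor B comes first in the
     tensor product, transposed. *)
  vec (A *m X *m B) = tensmx B^T A *m vec X.
Proof.
apply/colP => k; case: (mxtens_indexP k) => l i.
rewrite mxE -mxvec_index_tens mxvecE !mxE (reindex _ (curry_mxvec_bij _ _)) /=.
transitivity (\sum_(u : 'I_p * 'I_n) B u.1 l * A i u.2 * X u.2 u.1).
  rewrite -(pair_bigA _ (fun j k => B j l * A i k * X k j)) /=.
  apply: eq_bigr => j _; rewrite mxE mulr_suml; apply: eq_bigr => u _.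
  by rewrite mulrC mulrA.
apply: eq_bigr => -[j u] _ /=.
by rewrite [vec X _ _]mxE mxvecE [X^T _ _]mxE !mxvec_index_tens tensmxE mxE.
Qed.

(** * Positive semidefinite matrices and uniqueness of their square roots *)

Lemma dot_self_ge0 {R : realType} {d : nat} (x : 'cV[R]_d) :
  0 <= (x^T *m x) 0 0.
Proof. by rewrite mxE; apply: sumr_ge0 => i _; rewrite mxE -expr2 sqr_ge0. Qed.

Lemma dot_self_eq0 {R : realType} {d : nat} (x : 'cV[R]_d) :
  (x^T *m x) 0 0 = 0 -> x = 0.
Proof.
rewrite mxE => /eqP; rewrite psumr_eq0 => [/allP x0|i _]; last first.
  by rewrite mxE -expr2 sqr_ge0.
apply/colP => i; have := x0 i (mem_index_enum _).
by rewrite !mxE -expr2 sqrf_eq0 => /eqP.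
Qed.

Lemma is_psd_gram {R : realType} {m n : nat} (A : 'M[R]_(m, n)) :
  is_psd (A *m A^T).
Proof.
split=> [|x]; first by rewrite trmx_mul trmxK.
by have := dot_self_ge0 (A^T *m x); rewrite trmx_mul trmxK !mulmxA.
Qed.

(* The form is evaluated at x + h S x, with h < 0. *)
Lemma is_psd_ker {R : realType} {d : nat} {S : 'M[R]_d} {x : 'cV[R]_d} :
  is_psd S -> (x^T *m S *m x) 0 0 = 0 -> S *m x = 0.
Proof.
move=> [ST S_ge0] xSx; set y := S *m x; apply: dot_self_eq0.
pose a : R := (y^T *m y) 0 0; pose b : R := (y^T *m S *m y) 0 0; rewrite -/a.
have b_ge0 : 0 <= b := S_ge0 y.
have yT : x^T *m S = y^T by rewrite /y trmx_mul ST.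
have E h : ((x + h *: y)^T *m S *m (x + h *: y)) 0 0 = 2 * h * a + h ^+ 2 * b.
  have -> : (x + h *: y)^T *m S *m (x + h *: y) =
      x^T *m S *m x + h *: (y^T *m y) + h *: (y^T *m y) +
      h ^+ 2 *: (y^T *m S *m y).
    rewrite [(_ + _)^T]linearD /= [(_ *: _)^T]linearZ /=.
    rewrite !mulmxDl !mulmxDr -!scalemxAl -!scalemxAr.
    by rewrite yT -[y^T *m S *m x]mulmxA -/y scalerA addrA.
  by move: xSx; rewrite /a /b !mxE => ->; ring.
(* This h is defined even when b = 0, and makes the form equal to -a^2 (b + 2) / (b + 1)^2, which is
   nonnegative only if a = 0. *)
have := S_ge0 (x + (- a / (b + 1)) *: y); rewrite E => H.
have b1 : 0 < b + 1 by lra.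
have {}H : 0 <= - a ^+ 2 * (b + 2).
  rewrite (_ : - a ^+ 2 * _ = (b + 1) ^+ 2 * (2 * (- a / (b + 1)) * a +
   (- a / (b + 1)) ^+ 2 * b)); first by rewrite mulr_ge0 // sqr_ge0.
  by field; rewrite gt_eqF.
nra.
Qed.

(* With D := S - T, S D + D T = S^2 - T^2 = 0, so the two nonnegative traces
   tr (D S D) and tr (D T D) add up to 0; hence S D = T D = 0 and D^2 = 0. *)
Lemma is_psd_sqr_inj {R : realType} {d : nat} (S T : 'M[R]_d) :
  is_psd S -> is_psd T -> S *m S = T *m T -> S = T.
Proof.
move=> Spsd Tpsd ST; have [SS S_ge0] := Spsd; have [TT T_ge0] := Tpsd.
set D := S - T; have DT : D^T = D by rewrite linearB /= SS TT.
(* Since D is symmetric, the diagonal of D P D consists of the values of the form P at the columns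
   of D. *)
have quad (P : 'M[R]_d) i :
    (D *m P *m D) i i = ((col i D)^T *m P *m col i D) 0 0.
  rewrite tr_col DT -row_mul !mxE; apply: eq_bigr => k _.
  by rewrite !mxE.
have DPD_ge0 (P : 'M[R]_d) i : is_psd P -> 0 <= (D *m P *m D) i i.
  by move=> [_ P_ge0]; rewrite quad.
have trD0 : \tr (D *m S *m D) + \tr (D *m T *m D) = 0.
  rewrite -(mulmxA D S) [\tr (D *m T *m D)]mxtrace_mulC -mxtraceD -mulmxDr.
  by rewrite mulmxBr [D *m T]mulmxBl subrKA ST subrr mulmx0 mxtrace0.
have kerD (P : 'M[R]_d) : is_psd P -> \tr (D *m P *m D) = 0 -> P *m D = 0.
  move=> Ppsd /eqP; rewrite psumr_eq0 => [/allP tr0|i _]; last exact: DPD_ge0.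
  apply/matrixP => k i.
  have /(is_psd_ker Ppsd) : ((col i D)^T *m P *m col i D) 0 0 = 0.
    by rewrite -quad; apply/eqP; have := tr0 i (mem_index_enum _).
  move=> /colP/(_ k); rewrite !mxE => Pik; rewrite -[RHS]Pik.
  by apply: eq_bigr => j _; rewrite [col _ _ _ _]mxE.
have tr_ge0 (P : 'M[R]_d) : is_psd P -> 0 <= \tr (D *m P *m D).
  by move=> Ppsd; apply: sumr_ge0 => i _; exact: DPD_ge0.
have [trS trT] := (tr_ge0 S Spsd, tr_ge0 T Tpsd).
have SD0 : S *m D = 0 by apply: kerD => //; lra.
have TD0 : T *m D = 0 by apply: kerD => //; lra.
have DD0 : D *m D = 0 by rewrite {1}/D mulmxBl SD0 TD0 subrr.
apply/eqP; rewrite -subr_eq0 -/D; apply/eqP/matrixP => k i.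
(* By symmetry of D, the squared norm of a column is a diagonal entry of D^2 = 0. *)
have : col i D = 0.
  apply: dot_self_eq0; have -> : ((col i D)^T *m col i D) 0 0 = (D *m D) i i.
    rewrite tr_col DT [LHS]mxE [RHS]mxE; apply: eq_bigr => j _.
    by rewrite [row _ _ _ _]mxE [col _ _ _ _]mxE.
  by rewrite DD0 mxE.
by move=> /colP/(_ k); rewrite [LHS]mxE [RHS]mxE => ->; rewrite mxE.
Qed.

(** * The chosen square root and the operator [Omega] *)

(** Uniqueness makes the choice by [get] harmless: exhibiting one root determines its value. *)
Lemma psd_sqrtE {R : realType} {d : nat} (P S : 'M[R]_d) :
  is_psd S -> S *m S = P -> psd_sqrt P = S.
Proof.
move=> Spsd SS; rewrite /psd_sqrt.
case: xgetP => [T _ [Tpsd TT]|/(_ S)/=]; last by case.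
by apply: is_psd_sqr_inj => //; rewrite TT.
Qed.

Lemma is_psdZ {R : realType} {d : nat} (a : R) (P : 'M[R]_d) :
  0 <= a -> is_psd P -> is_psd (a *: P).
Proof.
move=> a_ge0 [PT P_ge0]; split=> [|x]; first by rewrite linearZ /= PT.
by rewrite -scalemxAr -scalemxAl mxE mulr_ge0.
Qed.

(* No existence theorem for square roots is needed: when P has none, neither
   does a^2 P, and both sides are the default value 0 of get. *)
Lemma psd_sqrtZ {R : realType} {d : nat} (a : R) (P : 'M[R]_d) :
  0 <= a -> psd_sqrt (a ^+ 2 *: P) = a *: psd_sqrt P.
Proof.
(* The case a = 0 is split off because the last case scales a root of a^2 P by a^-1. *)
move=> a_ge0; have := a_ge0; rewrite le0r => /predU1P[->|a_gt0].
  rewrite expr0n !scale0r; apply: psd_sqrtE; last by rewrite mulmx0.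
  by split=> [|x]; rewrite ?trmx0 // mulmx0 mul0mx mxE.
have [[S [Spsd SS]]|noS] := pselect (exists S : 'M[R]_d, is_psd S /\ S *m S = P).
  rewrite (psd_sqrtE _ _ Spsd SS); apply: psd_sqrtE; first exact: is_psdZ.
  by rewrite -scalemxAl -scalemxAr scalerA SS.
rewrite /psd_sqrt !getPN; first by apply/matrixP => i j; rewrite !mxE mulr0.
  by move=> S [Spsd SS]; apply: noS; exists S.
move=> S [Spsd SS]; apply: noS; exists (a^-1 *: S); split.
  by apply: is_psdZ; rewrite // invr_ge0.
rewrite -scalemxAl -scalemxAr scalerA SS scalerA -expr2 -exprMn.
by rewrite mulVf ?gt_eqF // expr1n scale1r.
Qed.

Lemma OmegaZ {R : realType} {d : nat} (a : R) (C : 'M[R]_d) :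
  0 <= a -> Omega (a *: C) = a *: Omega C.
Proof.
move=> a_ge0.
rewrite /Omega [(a *: C)^T]linearZ /= -!scalemxAl -!scalemxAr !scalerA -expr2.
rewrite !psd_sqrtZ//.
by apply/matrixP => i j; rewrite !mxE; ring.
Qed.

Lemma Omega_balanced {R : realType} {d : nat} (K Q G : 'M[R]_d) :
  Q^T *m Q = K^T *m K ->
  Omega (K *m Q^T) *m vec G = vec (G *m (Q *m Q^T) + (K *m K^T) *m G).
Proof.
move=> bal.
(* With W = K Q^T, W^T W = Q (K^T K) Q^T = Q (Q^T Q) Q^T = (Q Q^T)^2, and symmetrically for W
   W^T. *)
rewrite /Omega trmx_mul trmxK (psd_sqrtE _ (Q *m Q^T)); last 2 first.
- exact: is_psd_gram.
- by rewrite mulmxA -(mulmxA Q) bal !mulmxA.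
rewrite (psd_sqrtE _ (K *m K^T)); last 2 first.
- exact: is_psd_gram.
- by rewrite mulmxA -(mulmxA K) -bal !mulmxA.
have vecD (A B : 'M[R]_d) : vec (A + B) = vec A + vec B.
  by rewrite /vec !linearD.
rewrite vecD mulmxDl; congr (_ + _).
  by rewrite -[G in RHS]mul1mx vec_mulmx trmx_mul trmxK.
by rewrite -[K *m K^T *m G]mulmx1 vec_mulmx trmx1.
Qed.

(** * Limits and velocities of matrix curves *)

(** A neighbourhood of a matrix contains a product of neighbourhoods of its finitely many entries,
    and a filter is closed under finite intersections. *)
Lemma cvg_mxP {R : realType} {T : Type} {m n : nat} (F : set_system T)
    (f : T -> 'M[R]_(m, n)) (A : 'M[R]_(m, n)) {FF : Filter F} :
  (f x @[x --> F] --> A) <-> (forall i j, f x i j @[x --> F] --> A i j).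
Proof.
split=> [fA i j|fA B [P AP PB]].
  exact: (cvg_comp _ _ fA (@coord_continuous R m n i j A)).
apply: (@filterS _ F _ (fun x => forall i j, P i j (f x i j))).
  by move=> x Px; exact: PB.
apply: filter_forall => i; apply: filter_forall => j.
exact: (fA i j _ (AP i j)).
Qed.

Lemma cvg_mulmx {R : realType} {T : Type} {m n p : nat} (F : set_system T)
    (f : T -> 'M[R]_(m, n)) (g : T -> 'M[R]_(n, p))
    (A : 'M[R]_(m, n)) (B : 'M[R]_(n, p)) :
  Filter F -> f x @[x --> F] --> A -> g x @[x --> F] --> B ->
  f x *m g x @[x --> F] --> A *m B.
Proof.
move=> FF /cvg_mxP fA /cvg_mxP gB; apply/cvg_mxP => i j.
rewrite mxE; under eq_cvg do rewrite mxE.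
by apply: cvg_big => [|k _]; [exact: add_continuous|exact: cvgM].
Qed.

(** Differentiability implies continuity, relative to J: W s is W t plus (s - t) times the
    difference quotient. *)
Lemma velocity_cvg {R : realType} {m n : nat} (J : set R)
    (W : R -> 'M[R]_(m, n)) t V :
  has_velocity J W t V -> W s @[s --> within J t^'] --> W t.
Proof.
move=> WV; have st0 : (s - t) @[s --> within J t^'] --> (0 : R).
  rewrite -(subrr t); apply: cvgB; last exact: cvg_cst.
  (* The punctured relative filter is two nested [within] over the neighbourhoods of t. *)
  by move=> P tP; rewrite /= nbhs_filterE; do 2!apply: cvg_within.
have : W t + (s - t) *: ((s - t)^-1 *: (W s - W t)) @[s --> within J t^'] -->
    W t + 0 *: V.
  by apply: cvgD; [exact: cvg_cst|exact: cvgZ].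
rewrite scale0r addr0; apply: cvg_trans; apply: near_eq_cvg.
have : \forall s \near within J t^', s != t.
  by apply: cvg_within; exact: withinT.
apply: filterS => s st /=.
by rewrite scalerA divff ?subr_eq0 // scale1r addrC subrK.
Qed.

(** Product rule, from the splitting (A s - A t) B s + A t (B s - B t); the factor B s converges by
    [velocity_cvg]. *)
Lemma velocity_mulmx {R : realType} {m n p : nat} {J : set R}
    {A : R -> 'M[R]_(m, n)} {B : R -> 'M[R]_(n, p)} {t A' B'} :
  has_velocity J A t A' -> has_velocity J B t B' ->
  has_velocity J (fun s => A s *m B s) t (A' *m B t + A t *m B').
Proof.
move=> AA' BB'; rewrite /has_velocity.
have -> : (fun s => (s - t)^-1 *: (A s *m B s - A t *m B t)) =
    (fun s => ((s - t)^-1 *: (A s - A t)) *m B s +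
              A t *m ((s - t)^-1 *: (B s - B t))).
  apply/funext => s; rewrite -scalemxAl -scalemxAr -scalerDr mulmxBl mulmxBr.
  by rewrite addrA subrK.
apply: cvgD; apply: cvg_mulmx => //; last exact: cvg_cst.
exact: velocity_cvg BB'.
Qed.

Lemma velocity_trmx {R : realType} {m n : nat} {J : set R}
    {A : R -> 'M[R]_(m, n)} {t A'} :
  has_velocity J A t A' -> has_velocity J (fun s => (A s)^T) t A'^T.
Proof.
move=> /cvg_mxP AA'; apply/cvg_mxP => i j; have := AA' j i.
rewrite mxE.
rewrite (_ : (fun s => _) =
  (fun s => ((s - t)^-1 *: ((A s)^T - (A t)^T)) i j)) //.
by apply/funext => s; rewrite !mxE.
Qed.

Lemma velocityB {R : realType} {m n : nat} {J : set R}
    {A B : R -> 'M[R]_(m, n)} {t A' B'} :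
  has_velocity J A t A' -> has_velocity J B t B' ->
  has_velocity J (fun s => A s - B s) t (A' - B').
Proof.
move=> AA' BB'; rewrite /has_velocity.
have -> : (fun s => (s - t)^-1 *: (A s - B s - (A t - B t))) =
    (fun s => ((s - t)^-1 *: (A s - A t)) - ((s - t)^-1 *: (B s - B t))).
  apply/funext => s; rewrite -scalerBr !opprB addrACA [in RHS]addrACA.
  by rewrite [- B s - _]addrC.
exact: cvgB.
Qed.

(** * Curves with zero velocity are constant *)

(** Positive times are interior, so there the relative velocity is an ordinary derivative. *)
Lemma time_domain_near {R : realType} {tau : \bar R} {x : R} :
  0 < x -> time_domain tau x -> \forall s \near x, time_domain tau s.
Proof.
move=> x_gt0 [_ x_tau].
(* A real bound b stands in for tau, which may be infinite. *)
have [b xb b_tau] : exists2 b : R, x < b & (b%:E <= tau)%E.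
  case: tau x_tau => [r||]//; first by rewrite lte_fin; exists r.
  by exists (x + 1); rewrite ?ltrDl ?leey.
near=> s; split.
  by apply: ltW; near: s; exact: lt_nbhsr.
apply: lt_le_trans b_tau; rewrite lte_fin.
by near: s; exact: lt_nbhsl.
Unshelve. all: by end_near. Qed.

(** The mean value theorem is applied to each entry on [0, t]. *)
Lemma velocity0_cst {R : realType} {m n : nat} (tau : \bar R)
    (W : R -> 'M[R]_(m, n)) :
  (forall t, time_domain tau t -> has_velocity (time_domain tau) W t 0) ->
  forall t, time_domain tau t -> W t = W 0.
Proof.
move=> W0 t [t_ge0 t_tau].
have := t_ge0; rewrite le0r => /predU1P[->//|t_gt0].
have sub0t s : 0 <= s -> s <= t -> time_domain tau s.
  by move=> s_ge0 st; split=> //; apply: le_lt_trans t_tau; rewrite lee_fin.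
apply/matrixP => i j; pose f s := W s i j.
have fq x : time_domain tau x ->
    (s - x)^-1 * (f s - f x) @[s --> within (time_domain tau) x^'] --> (0 : R).
  move=> /W0/cvg_mxP/(_ i j); rewrite mxE.
  rewrite (_ : (fun s => _) = (fun s => (s - x)^-1 * (f s - f x))) //.
  by apply/funext => s; rewrite !mxE.
have fc x : time_domain tau x ->
    f s @[s --> within (time_domain tau) x^'] --> f x.
  by move=> /W0/velocity_cvg/cvg_mxP; exact.
(* The end point t is included, being interior to the time domain; this also yields left continuity
   at t. *)
have f' x : x \in `]0, t]%R -> is_derive x 1 f 0.
  rewrite in_itv /= => /andP[x_gt0 xt].
  have Jx := sub0t x (ltW x_gt0) xt.
  (* The substitution s = h + x carries the quotient of the library derivative to the relative one,
     as the time domain is a neighbourhood of x. *)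
  have shift : h *: 1 + x @[h --> 0^'] --> within (time_domain tau) x^'.
    move=> P xP.
    have xP' : \forall s \near x, s != x -> P s.
      apply: filterS2 (time_domain_near x_gt0 Jx) xP => s Js Ps sx.
      exact: Ps.
    have hx : h *: 1 + x @[h --> (0 : R)] --> x.
      rewrite -[X in _ --> X]add0r; under eq_cvg do rewrite [_%:A]mulr1.
      by apply: cvgD; [exact: cvg_id|exact: cvg_cst].
    have : \forall h \near (0 : R), h *: 1 + x != x -> P (h *: 1 + x) :=
      hx _ xP'.
    apply: (@filterS _ (nbhs (0 : R))) => h hP h0; apply: hP.
    by rewrite [_%:A]mulr1 -subr_eq0 addrK.
  have q0 : h^-1 *: (f (h *: 1 + x) - f x) @[h --> 0^'] --> (0 : R).
    have := cvg_comp _ _ shift (fq x Jx).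
    rewrite (_ : _ \o _ = fun h => h^-1 *: (f (h *: 1 + x) - f x)) //.
    by apply/funext => h /=; rewrite addrK [_%:A]mulr1.
  apply: DeriveDef; first by apply/cvg_ex; exists 0.
  exact: cvg_lim q0.
have fcont : {within `[0, t], continuous f}.
  apply/continuous_within_itvP => //; split.
  - move=> x /subset_itv_oo_oc xt; apply: differentiable_continuous.
    by apply/derivable1_diffP; have := f' x xt.
  (* At 0 the relative limit is a right limit: every s with 0 < s < t lies in the time domain. *)
  - move=> P /(fc 0 (sub0t 0 (lexx 0) t_ge0)) Pf.
    apply: filterS2 (lt_nbhsl t_gt0) Pf => s st Ps s_gt0.
    by apply: Ps; [rewrite gt_eqF|apply: sub0t; exact: ltW].
  - apply: cvg_at_left_filter.
    apply: differentiable_continuous; apply/derivable1_diffP.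
    have /f'[+ _] : t \in `]0, t] by rewrite in_itv /= t_gt0 lexx.
    exact.
have [c _] := MVT_segment t_ge0 (fun x xt => f' x (subset_itv_oo_oc xt)) fcont.
by rewrite mul0r => /subr0_eq.
Qed.

(** * Gradients and the chain rule for matrix products *)

(** The differential is linear in its direction, and V expands in the basis of the
    [delta_mx i j]. *)
Lemma deriveE_grad {R : realType} {m n : nat} (f : 'M[R]_(m, n) -> R)
    (C V : 'M[R]_(m, n)) :
  differentiable f C ->
  'D_V f C = \sum_i \sum_j V i j * grad f C i j.
Proof.
move=> df; rewrite deriveE // {1}(matrix_sum_delta V) linear_sum.
apply: eq_bigr => i _; rewrite linear_sum; apply: eq_bigr => j _.
by rewrite linearZ mxE deriveE.
Qed.

(** The two difference quotients coincide before the limit, since L (h v + u) = h L v + L u. *)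
Lemma derive_comp_linear {R : realType} {U V : normedModType R} (f : V -> R)
    (L : {linear U -> V}) (u v : U) :
  'D_v (f \o L) u = 'D_(L v) f (L u).
Proof.
rewrite /derive.
by under [in LHS]eq_fun do rewrite /= [L (_ + _)]linearD [L (_ *: _)]linearZ.
Qed.

(** Moving K along [delta_mx i j] moves K B along a matrix whose only possibly nonzero row, the
    i-th, is row j of B; pairing it with the gradient leaves one entry of the product with B^T. *)
Lemma grad_mulmxr {R : realType} {m n p : nat} (f : 'M[R]_(m, p) -> R)
    (K : 'M[R]_(m, n)) (B : 'M[R]_(n, p)) :
  differentiable f (K *m B) ->
  grad (fun K => f (K *m B)) K = grad f (K *m B) *m B^T.
Proof.
move=> df; apply/matrixP => i j; rewrite [LHS]mxE.
rewrite (derive_comp_linear f (mulmxr B)) /= deriveE_grad // [RHS]mxE.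
rewrite (bigD1 i) //= [X in _ + X]big1 ?addr0 => [|k ki]; last first.
  apply: big1 => l _; rewrite mxE big1 ?mul0r // => q _.
  by rewrite mxE (negPf ki) mul0r.
apply: eq_bigr => l _; rewrite mulrC; congr (_ * _).
rewrite !mxE (bigD1 j) //= mxE !eqxx mul1r big1 ?addr0 // => q qj.
by rewrite mxE (negPf qj) andbF mul0r.
Qed.

Lemma grad_trmx {R : realType} {m n : nat} (f : 'M[R]_(n, m) -> R)
    (K : 'M[R]_(m, n)) :
  grad (fun K => f K^T) K = (grad f K^T)^T.
Proof.
apply/matrixP => i j; rewrite !mxE.
by rewrite (derive_comp_linear f trmx) /= trmx_delta.
Qed.

(** Writing A Q^T = (Q A^T)^T reduces this to [grad_mulmxr] for N |-> f N^T. *)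
Lemma grad_mulmx_trmx {R : realType} {m n p : nat} (f : 'M[R]_(m, p) -> R)
    (A : 'M[R]_(m, n)) (Q : 'M[R]_(p, n)) :
  differentiable f (A *m Q^T) ->
  grad (fun Q => f (A *m Q^T)) Q = (grad f (A *m Q^T))^T *m A.
Proof.
move=> df.
have dft : differentiable (fun N : 'M[R]_(p, m) => f N^T) (Q *m A^T).
  apply: differentiable_comp; last by rewrite trmx_mul trmxK.
  apply: linear_differentiable => N; apply/(cvg_mxP (nbhs N)) => i j.
  rewrite mxE; under eq_cvg do rewrite mxE.
  exact: coord_continuous.
rewrite (_ : (fun Q => _) = (fun Q => f (Q *m A^T)^T)); last first.
  by apply/funext => B; rewrite trmx_mul trmxK.
by rewrite (grad_mulmxr _ _ _ dft) grad_trmx trmx_mul !trmxK.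
Qed.

(** * Differentiability of the loss *)

Lemma differentiable_expR {R : realType} {V : normedModType R} (f : V -> R) x :
  differentiable f x -> differentiable (fun y => expR (f y)) x.
Proof.
move=> df; apply: differentiable_comp df _.
by apply/derivable1_diffP; exact: derivable_expR.
Qed.

Lemma differentiable_bigsum {R : realType} {V : normedModType R} {k : nat}
    (f : 'I_k -> V -> R) x :
  (forall i, differentiable (f i) x) ->
  differentiable (fun y => \sum_i f i y) x.
Proof.
move=> df; rewrite (_ : (fun y => _) = \sum_i f i); first exact: differentiable_sum.
by apply/funext => y; rewrite fct_sumE.
Qed.

(** The index i witnesses that the sum is nonempty. *)
Lemma sum_expR_gt0 {R : realType} {k : nat} (u : 'I_k -> R) (i : 'I_k) :
  0 < \sum_j expR (u j).
Proof.
rewrite (bigD1 i) //= ltr_wpDr ?expR_gt0 //.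
by apply: sumr_ge0 => j _; exact: expR_ge0.
Qed.

Lemma differentiable_softmax {R : realType} {V : normedModType R} {k : nat}
    (u : V -> 'cV[R]_k) x i :
  (forall j, differentiable (fun y => u y j 0) x) ->
  differentiable (fun y => softmax (u y) i 0) x.
Proof.
move=> du; rewrite (_ : (fun y => _) =
    (fun y => expR (u y i 0) * (\sum_j expR (u y j 0))^-1));
  last by apply/funext => y; rewrite mxE.
apply: differentiableM; first exact: differentiable_expR.
apply: differentiableV.
  by apply: differentiable_bigsum => j; exact: differentiable_expR.
by rewrite gt_eqF // (sum_expR_gt0 _ i).
Qed.

Lemma differentiable_mulmxl {R : realType} {V : normedModType R} {m n p : nat}
    (A : 'M[R]_(m, n)) (f : V -> 'M[R]_(n, p)) x i k :
  (forall j l, differentiable (fun y => f y j l) x) ->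
  differentiable (fun y => (A *m f y) i k) x.
Proof.
move=> df; rewrite (_ : (fun y => _) = (fun y => \sum_j (A i j *: f y j k)));
  last by apply/funext => y; rewrite mxE.
by apply: differentiable_bigsum => j; apply: differentiableZ.
Qed.

(** The layers are peeled from the outside: logarithm at a positive probability, softmax, linear
    logits, attention softmax, and scores linear in C. *)
Lemma differentiable_loss {R : realType} {n d M : nat} (WO : 'M[R]_(M, d))
    (WV : 'M[R]_d) (X : 'M[R]_(n.+1, d)) (c : 'I_M) (C : 'M[R]_d) :
  differentiable (loss WO WV X c) C.
Proof.
pose prob C := softmax (logits WO WV X C) c 0.
have gt0 : 0 < prob C.
  by rewrite /prob mxE divr_gt0 ?expR_gt0 // (sum_expR_gt0 _ c).
rewrite (_ : loss _ _ _ _ = - (@ln R \o prob)) //.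
apply: differentiableN; apply: differentiable_comp; last first.
  by apply/derivable1_diffP; have [] := is_derive1_ln gt0.
apply: differentiable_softmax => j.
apply: differentiable_mulmxl => k l; rewrite ord1.
apply: differentiable_softmax => p.
(* Reassociating exposes a constant left factor X applied to C times the query. *)
under eq_fun do rewrite -mulmxA.
apply: differentiable_mulmxl => q r.
rewrite (_ : (fun y => _) = (fun y : 'M[R]_d => \sum_s (query X s r *: y q s)));
  last by apply/funext => y; rewrite mxE; apply: eq_bigr => s _; rewrite mulrC.
apply: differentiable_bigsum => s; apply: differentiableZ.
exact: differentiable_coord.
Qed.

(** * Conservation of balance and the velocity of the product *)

Theorem lemma5 (R : realType) (n d M : nat) (X : 'M[R]_(n.+1, d)) (c : 'I_M)
    (WO : R -> 'M[R]_(M, d)) (WV : R -> 'M[R]_d) :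
  (forall (tau : \bar R) (WK WQ : R -> 'M[R]_d),
      (0 < tau)%E ->
      (forall t : R, time_domain tau t ->
         has_velocity (time_domain tau) WK t
           (- grad (fun K : 'M[R]_d =>
                      loss (WO t) (WV t) X c (K *m (WQ t)^T)) (WK t)) /\
         has_velocity (time_domain tau) WQ t
           (- grad (fun Q : 'M[R]_d =>
                      loss (WO t) (WV t) X c (WK t *m Q^T)) (WQ t))) ->
      (WQ 0)^T *m WQ 0 = (WK 0)^T *m WK 0 ->
      forall t : R, time_domain tau t ->
        let Wtilde := fun s : R => WK s *m (WQ s)^T in
        exists2 V : 'M[R]_d,
          has_velocity (time_domain tau) Wtilde t V &
          vec V = Omega (Wtilde t) *m
                  vec (- grad (loss (WO t) (WV t) X c) (Wtilde t))) /\
  (forall (alpha : R) (C : 'M[R]_d),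
      0 <= alpha -> Omega (alpha *: C) = alpha *: Omega C).
Proof.
split=> [tau WK WQ _ flow bal0 t Jt Wtilde|alpha C]; last exact: OmegaZ.
set J := time_domain tau in flow *.
pose G s := - grad (loss (WO s) (WV s) X c) (Wtilde s).
have flowK s : J s -> has_velocity J WK s (G s *m WQ s).
  move=> /flow[+ _]; rewrite grad_mulmxr ?trmxK ?mulNmx //.
  exact: differentiable_loss.
have flowQ s : J s -> has_velocity J WQ s ((G s)^T *m WK s).
  move=> /flow[_]; rewrite grad_mulmx_trmx; last exact: differentiable_loss.
  by rewrite /G linearN mulNmx.
have bal : (WQ t)^T *m WQ t - (WK t)^T *m WK t = 0.
  rewrite (velocity0_cst tau (fun s => (WQ s)^T *m WQ s - (WK s)^T *m WK s)) //.
    by rewrite bal0 subrr.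
  move=> s Js.
  have vQ := velocity_mulmx (velocity_trmx (flowQ s Js)) (flowQ s Js).
  have vK := velocity_mulmx (velocity_trmx (flowK s Js)) (flowK s Js).
  (* Both Gram matrices have velocity K^T G Q + Q^T G^T K, with the summands in opposite orders, so
     the difference is 0. *)
  have := velocityB vQ vK.
  by rewrite !trmx_mul trmxK !mulmxA [X in _ - X]addrC subrr.
have := velocity_mulmx (flowK t Jt) (velocity_trmx (flowQ t Jt)).
rewrite trmx_mul trmxK => vW; eexists; first exact: vW.
rewrite Omega_balanced; last exact: subr0_eq.
by rewrite !mulmxA.
Qed.
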